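(* Let $n_1\geq n_2\geq n_3\geq 0$ be integers. The capacity region $\mathcal{C}$ of the linear shift deterministic Y-channel DYC$(n_1,n_2,n_3)$ is $\overline{\mathcal{C}}$, where $\overline{\mathcal{C}}$ is the set of all $\mathbf{R}=(R_{12},R_{13},R_{21},R_{23},R_{31},R_{32})\in\mathbb{R}_+^6$ satisfying \begin{align*} R_{12}+R_{32}+R_{13}&\leq n_2,\\ R_{12}+R_{32}+R_{31}&\leq n_1,\\ R_{21}+R_{31}+R_{32}&\leq n_2,\\ R_{21}+R_{31}+R_{23}&\leq n_2,\\ R_{13}+R_{23}+R_{12}&\leq n_2,\\ R_{13}+R_{23}+R_{21}&\leq n_1,\\ R_{31}+R_{32}&\leq n_3,\\ R_{13}+R_{23}&\leq n_3. \end{align*}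
   Context: The channel. $\mathbb{R}_+$ denotes the nonnegative reals. Let $n_1\ge n_2\ge n_3\ge 0$ be integers and $q=\max_j n_j=n_1$. Let $\mathbf{S}$ be the $q\times q$ down-shift matrix over $\mathbb{F}_2$, so that $\mathbf{S}^{m}$ shifts the entries of a vector down by $m$ positions, filling with zeros ($\mathbf{S}^0=I$). The linear shift deterministic Y-channel DYC$(n_1,n_2,n_3)$ has three users $1,2,3$ and a relay $r$, all full-duplex, with no direct links between users. At each time $i$, user $j$ sends $\mathbf{x}_{ji}\in\mathbb{F}_2^q$ and the relay sends $\mathbf{x}_{ri}\in\mathbb{F}_2^q$; the relay and user $j$ receive, respectively, $$\mathbf{y}_{ri}=\sum_{j=1}^3\mathbf{S}^{q-n_j}\mathbf{x}_{ji},\qquad \mathbf{y}_{ji}=\mathbf{S}^{q-n_j}\mathbf{x}_{ri},$$ with all operations over $\mathbb{F}_2$. Codes. Let $R_{jk}\in\mathbb{R}_+$ for all distinct $j,k\in\{1,2,3\}$. User $j$ has a message $m_{jk}$ for user $k$, uniformly distributed over the set $\mathcal{M}_{jk}=\{1,\dots,2^{nR_{jk}}\}$; the six messages are independent. A code of length $n$ for the rate tuple $\mathbf{R}=(R_{12},R_{13},R_{21},R_{23},R_{31},R_{32})$ consists of these message sets; user encoders $\mathbf{x}_{ji}=f_{ji}(m_{jk},m_{jl},\mathbf{y}_{j1},\dots,\mathbf{y}_{j,i-1})$ for $\{j,k,l\}=\{1,2,3\}$ and $1\le i\le n$; relay encoders $\mathbf{x}_{ri}=f_{ri}(\mathbf{y}_{r1},\dots,\mathbf{y}_{r,i-1})$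 for $1\le i\le n$; and decoders $(\hat m_{kj},\hat m_{lj})=g_j(\mathbf{y}_{j1},\dots,\mathbf{y}_{jn},m_{jk},m_{jl})$ for each user $j$. An error occurs if $(\hat m_{kj},\hat m_{lj})\ne(m_{kj},m_{lj})$ for some user $j$. Achievability. The rate tuple $\mathbf{R}$ is achievable if there exists a sequence of such codes for $\mathbf{R}$ whose average error probability can be made arbitrarily small by increasing $n$. The capacity region $\mathcal{C}$ is the set of all achievable rate tuples.
   Formalization: The capacity region is taken as the closure of the set of achievable rate tuples: without closure the equality fails, e.g. for (1,1,1) the tuple R=(1,0,0,0,0,0) satisfies all the inequalities but is not achievable, as the relay's first output is constant. *)

(* Defs.v *)
From HB Require Import structures.
From mathcomp Require Import all_boot all_order all_algebra.
From mathcomp Require Import all_classical all_reals all_analysis.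

Set Implicit Arguments.
Unset Strict Implicit.
Unset Printing Implicit Defensive.

Import Order.TTheory GRing.Theory Num.Theory.
Import numFieldNormedType.Exports.

Local Open Scope classical_set_scope.
Local Open Scope ring_scope.

Definition user := 'I_3.
Definition u1 : user := @Ordinal 3 0 isT.
Definition u2 : user := @Ordinal 3 1 isT.
Definition u3 : user := @Ordinal 3 2 isT.

(* [link] indexes the six messages: (j, k) stands for "from j to k". *)
Definition link := {jk : user * user | jk.1 != jk.2}.
Definition src (l : link) : user := (val l).1.
Definition dst (l : link) : user := (val l).2.

Definition l12 : link := exist _ (u1, u2) isT.
Definition l13 : link := exist _ (u1, u3) isT.
Definition l21 : link := exist _ (u2, u1) isT.
Definition l23 : link := exist _ (u2, u3) isT.
Definition l31 : link := exist _ (u3, u1) isT.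
Definition l32 : link := exist _ (u3, u2) isT.

(* Row 0 is the top of a vector. *)
Definition down_shift (q : nat) : 'M['F_2]_q :=
  \matrix_(i < q, j < q) (nat_of_ord i == j.+1)%:R.

Section Messages.
Variable M : link -> nat.

(* The set {1, ..., M l} is represented by 'I_(M l) = {0, ..., M l - 1}. *)
Definition messages := {dffun forall l : link, 'I_(M l)}.
Definition sent (j : user) :=
  {dffun forall l : {l : link | src l == j}, 'I_(M (val l))}.
Definition wanted (j : user) :=
  {dffun forall l : {l : link | dst l == j}, 'I_(M (val l))}.

Definition sent_of (w : messages) (j : user) : sent j :=
  [ffun l : {l : link | src l == j} => w (val l)].
Definition wanted_of (w : messages) (j : user) : wanted j :=
  [ffun l : {l : link | dst l == j} => w (val l)].
End Messages.

Section Channel.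
Variable N : user -> nat.

Definition levels : nat := (\max_(j : user) N j)%N.
Definition symbol := 'cV['F_2]_levels.

Definition link_matrix (j : user) : 'M['F_2]_levels :=
  down_shift levels ^+ (levels - N j)%N.

Definition uplink (x : user -> symbol) : symbol :=
  \sum_(j : user) link_matrix j *m x j.
Definition downlink (x : symbol) (j : user) : symbol := link_matrix j *m x.

(* The index i of an encoder is the number of past outputs, so that it is used
   at time i + 1; the encoders with n <= i are never used. *)
Record code (n : nat) (M : link -> nat) := Code {
  user_enc : forall (j : user) (i : nat), sent M j -> i.-tuple symbol -> symbol;
  relay_enc : forall i : nat, i.-tuple symbol -> symbol;
  decoder : forall j : user, n.-tuple symbol -> sent M j -> wanted M j
}.

(* Outputs of the relay and of the users at times 1, ..., t. *)
Fixpoint outputs (n : nat) (M : link -> nat) (C : code n M) (w : messages M)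
    (t : nat) : t.-tuple symbol * (user -> t.-tuple symbol) :=
  match t with
  | 0 => ([tuple], fun=> [tuple])
  | i.+1 =>
    let: (yr, yu) := outputs C w i in
    let xu j := user_enc C (sent_of w j) (yu j) in
    let xr := relay_enc C yr in
    (rcons_tuple yr (uplink xu), fun j => rcons_tuple (yu j) (downlink xr j))
  end.

Definition decoding_error (n : nat) (M : link -> nat) (C : code n M)
    (w : messages M) : bool :=
  [exists j : user,
    decoder C ((outputs C w n).2 j) (sent_of w j) != wanted_of w j].

(* Independent uniform messages: w is uniform on the finite type [messages M]. *)
Definition error_probability (R : realType) (n : nat) (M : link -> nat)
    (C : code n M) : R :=
  #|[pred w : messages M | decoding_error C w]|%:R / #|{: messages M}|%:R.

End Channel.

(* R^6 with its usual (product) topology. *)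
Definition rate_tuple (R : realType) := {ptws link -> R}.

(* Since 2^(n r) need not be an integer, {1, ..., 2^(n r)} is the set of the
   positive integers that are at most 2^(n r). *)
Definition message_count (R : realType) (n : nat) (r : rate_tuple R) (l : link) : nat :=
  Num.truncn (2 `^ (n%:R * r l)).

Definition achievable (R : realType) (N : user -> nat) (r : rate_tuple R) : Prop :=
  (forall l : link, 0 <= r l) /\
  exists C : forall n : nat, code N n (message_count n r),
    (fun n => error_probability R (C n)) @ \oo --> (0 : R).

(* The closure is needed for boundary points: the relay's first output does not
   depend on the messages, so that, e.g., for N = (1, 1, 1) no code of length n
   conveys 2^n messages from user 1 to user 2 with error probability < 1/2. *)
Definition capacity_region (R : realType) (N : user -> nat) : set (rate_tuple R) :=
  closure [set r : rate_tuple R | achievable N r].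
Arguments capacity_region R N : clear implicits.

Definition DYC (n1 n2 n3 : nat) (j : user) : nat := nth 0%N [:: n1; n2; n3] j.

Definition Cbar (R : realType) (n1 n2 n3 : nat) : set (rate_tuple R) :=
  [set r : rate_tuple R | (forall l : link, 0 <= r l) /\
    [/\ [/\ r l12 + r l32 + r l13 <= n2%:R,
            r l12 + r l32 + r l31 <= n1%:R,
            r l21 + r l31 + r l32 <= n2%:R &
            r l21 + r l31 + r l23 <= n2%:R],
        r l13 + r l23 + r l12 <= n2%:R,
        r l13 + r l23 + r l21 <= n1%:R,
        r l31 + r l32 <= n3%:R &
        r l13 + r l23 <= n3%:R]].
Arguments Cbar R n1 n2 n3 : clear implicits.

(* Main.v *)
(** Converse: if the messages outside a set S of links together with k bits per
    channel use observed at one terminal determine all the messages, then the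
    rates of S sum to at most k. The k bits are either a user's observation, which
    contains those of the weaker users, or the lowest levels of the relay's
    observation; in the second case the higher levels come from users whose
    messages are all outside S, and the relay's past determines their inputs.
    Correctly decoded message tuples then inject into the messages outside S times
    2^(kn) signals, so no entropy is needed.

    Achievability: in blocks of K uses the relay only permutes the levels that it
    received during the previous block. A level carries either a sum of two bits
    exchanged by a pair of users, or one of the two sums x_12 + x_23, x_23 + x_31
    (or x_13 + x_21, x_13 + x_32) that serve a three-user cycle with two levels for
    three bits, or a single bit. Serving pairs first, then the cycles, then the
    rest, the eight inequalities are exactly what is needed to fit the levels into
    the nested sets that the users can reach. *)

From mathcomp Require Import all_boot all_order all_algebra.
From mathcomp Require Import all_classical all_reals all_analysis.
From mathcomp Require Import zify.
Require Import Defs.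

Set Implicit Arguments.
Unset Strict Implicit.
Unset Printing Implicit Defensive.

Import Order.TTheory GRing.Theory Num.Theory.

(* Indices beyond the last row read as 0. *)
Definition entry {q : nat} (x : 'cV['F_2]_q) (i : nat) : 'F_2 :=
  if insub i is Some r then x r ord0 else 0%R.

(** * The channel, row by row *)

Section Channel.
Variable N : user -> nat.
Local Notation q := (levels N).
Local Notation symbol := (symbol N).
Local Open Scope ring_scope.

Lemma entry_col (p : nat) (f : nat -> 'F_2) (i : nat) :
  entry (\col_(r < p) f r) i = if (i < p)%N then f i else 0.
Proof. by rewrite /entry; case: insubP => [r -> <-|/negPf->//]; rewrite mxE. Qed.

Lemma entry_inj (p : nat) (x y : 'cV['F_2]_p) :
  (forall i, (i < p)%N -> entry x i = entry y i) -> x = y.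
Proof.
move=> xy; apply/matrixP => r c; rewrite ord1.
by have := xy r (ltn_ord r); rewrite /entry valK.
Qed.

Lemma entryD (p : nat) (x y : 'cV['F_2]_p) (i : nat) :
  entry (x + y) i = entry x i + entry y i.
Proof. by rewrite /entry; case: insub => [r|]; rewrite ?mxE ?addr0. Qed.

Lemma entry_sum (p : nat) (I : finType) (x : I -> 'cV['F_2]_p) (i : nat) :
  entry (\sum_j x j) i = \sum_j entry (x j) i.
Proof.
apply: (big_morph (fun v : 'cV['F_2]_p => entry v i)) => [u v|].
  exact: entryD.
by rewrite /entry; case: insub => [r|//]; rewrite mxE.
Qed.

Lemma entry_over (p : nat) (x : 'cV['F_2]_p) (i : nat) :
  (p <= i)%N -> entry x i = 0.
Proof. by move=> pi; rewrite /entry insubF // ltnNge pi. Qed.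

Lemma entry_down_shift (p : nat) (x : 'cV['F_2]_p) (i : nat) :
  entry (down_shift p *m x) i =
  if (0 < i < p)%N then entry x i.-1 else 0.
Proof.
rewrite {1}/entry; case: insubP => [r ip <-{i ip}|]; last first.
  by move=> /negPf ip; rewrite ip andbF.
rewrite ltn_ord andbT mxE; case: (posnP r) => [r0|r_gt0].
  by rewrite big1 // => j _; rewrite mxE r0 mul0r.
have r1p : (r.-1 < p)%N by rewrite (leq_ltn_trans (leq_pred r)).
rewrite (bigD1 (Ordinal r1p)) //= !mxE /= prednK // eqxx mul1r.
rewrite big1 ?addr0 ?/entry ?insubT // => j jr; rewrite mxE.
case: eqP => [rj|_]; last by rewrite mul0r.
by case/eqP: jr; apply: val_inj; rewrite /= rj.
Qed.

Lemma entry_down_shiftX (p m : nat) (x : 'cV['F_2]_p) (i : nat) :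
  entry (down_shift p ^+ m *m x) i =
  if (m <= i < p)%N then entry x (i - m) else 0.
Proof.
elim: m i => [|m IHm] i.
  rewrite expr0 mul1mx subn0 /=; case: ltnP => // pi; exact: entry_over.
rewrite exprS -mulmxA entry_down_shift IHm.
case: i => [|i] //=; rewrite ltnS subSS.
by case: (ltnP i.+1 p) => [/ltnW->|_]; rewrite ?andbT ?andbF.
Qed.

Lemma leq_levels j : (N j <= q)%N. Proof. exact: leq_bigmax. Qed.

Lemma entry_link (j : user) (x : symbol) (i : nat) :
  entry (link_matrix N j *m x) i =
  if (q - N j <= i < q)%N then entry x (i - (q - N j)) else 0.
Proof. exact: entry_down_shiftX. Qed.

(** Valued in a finite type with [2 ^ k] elements, so that the signals of a cut can be counted. *)
Definition bottom (k : nat) (x : symbol) : {ffun 'I_k -> 'F_2} :=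
  [ffun i : 'I_k => entry x (q - k + i)].

Lemma bottomP (k : nat) (x y : symbol) (i : nat) : (k <= q)%N ->
  bottom k x = bottom k y -> (q - k <= i)%N -> entry x i = entry y i.
Proof.
move=> kq xy ki; case: (ltnP i q) => [iq|qi]; last by rewrite !entry_over.
have ikk : (i - (q - k) < k)%N by lia.
by have /ffunP/(_ (Ordinal ikk)) := xy; rewrite !ffunE /= subnKC.
Qed.

(** User [j] sees the top [N j] rows of the relay's input, and the top [N k] rows are among
    these. *)
Lemma downlink_degraded (j k : user) (x y : symbol) : (N k <= N j)%N ->
  downlink x j = downlink y j -> downlink x k = downlink y k.
Proof.
move=> kj xy; apply: entry_inj => i iq; rewrite !entry_link iq andbT.
case: ifP => // ki; have := leq_levels j => jq.
have := congr1 (fun v : 'cV_q => entry v (i - (q - N k) + (q - N j))) xy.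
rewrite !entry_link addnK leq_addl /=.
by have -> : (i - (q - N k) + (q - N j) < q)%N by lia.
Qed.

Lemma downlink_bottom (j : user) (x y : symbol) :
  bottom (N j) (downlink x j) = bottom (N j) (downlink y j) ->
  downlink x j = downlink y j.
Proof.
move=> xy; apply: entry_inj => i iq.
case: (leqP (q - N j) i) => [|ij]; first exact: (bottomP (leq_levels j) xy).
by rewrite !entry_link leqNgt ij.
Qed.

(** Only users with more than [k] levels contribute to the rows above the bottom [k]. *)
Lemma uplink_bottom (k : nat) (x y : user -> symbol) : (k <= q)%N ->
  (forall j, (k < N j)%N -> x j = y j) ->
  bottom k (uplink x) = bottom k (uplink y) -> uplink x = uplink y.
Proof.
move=> kq xyj xy; apply: entry_inj => i iq.
case: (leqP (q - k) i) => [|ik]; first exact: (bottomP kq xy).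
rewrite !entry_sum; apply: eq_bigr => j _.
case: (ltnP k (N j)) => [/xyj -> //|jk].
by rewrite !entry_link leqNgt (leq_trans ik) // leq_sub2l.
Qed.

(** * What an observed signal determines *)

Section Code.
Variables (n : nat) (M : link -> nat) (C : code N n M).
Implicit Types w v : messages M.

Lemma outputs_degraded (j k : user) w v t : (N k <= N j)%N ->
  (outputs C w t).2 j = (outputs C v t).2 j ->
  (outputs C w t).2 k = (outputs C v t).2 k.
Proof.
move=> kj; elim: t => [|t IHt] //=.
case: (outputs C w t) (outputs C v t) IHt => [yr yu] [zr zu] /= IHt.
move=> /(congr1 val)/= /rcons_inj[/val_inj/IHt yz xz].
by apply: val_inj; rewrite /= yz (downlink_degraded kj xz).
Qed.

(** The relay has no message: its inputs, and with them all user outputs, are functions of its past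
    observations. *)
Lemma outputs_relay_user w v t :
  (outputs C w t).1 = (outputs C v t).1 ->
  forall j, (outputs C w t).2 j = (outputs C v t).2 j.
Proof.
elim: t => [|t IHt] //=.
case: (outputs C w t) (outputs C v t) IHt => [yr yu] [zr zu] /= IHt.
move=> /(congr1 val)/= /rcons_inj[/val_inj yz _] j.
by apply: val_inj; rewrite /= yz (IHt yz).
Qed.

Lemma outputs_bottom_user (j : user) w v t :
  map (bottom (N j)) ((outputs C w t).2 j) =
    map (bottom (N j)) ((outputs C v t).2 j) ->
  (outputs C w t).2 j = (outputs C v t).2 j.
Proof.
elim: t => [|t IHt] //=.
case: (outputs C w t) (outputs C v t) IHt => [yr yu] [zr zu] /= IHt.
rewrite !map_rcons => /rcons_inj[/IHt yz /downlink_bottom xz].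
by apply: val_inj; rewrite /= yz xz.
Qed.

(* The relay reproduces, from its own past, the inputs of the users whose
   messages are fixed; these are the only ones reaching above the bottom k rows. *)
Lemma outputs_bottom_relay (k : nat) w v t : (k <= q)%N ->
  (forall j, (k < N j)%N -> sent_of w j = sent_of v j) ->
  map (bottom k) (outputs C w t).1 = map (bottom k) (outputs C v t).1 ->
  (outputs C w t).1 = (outputs C v t).1.
Proof.
move=> kq wv; elim: t => [|t IHt] //=.
have := @outputs_relay_user w v t.
case: (outputs C w t) (outputs C v t) IHt => [yr yu] [zr zu] /= IHt Yu.
rewrite !map_rcons => /rcons_inj[/IHt yz xz].
apply: val_inj; rewrite /= yz; congr rcons.
by apply: uplink_bottom xz => // j /wv ->; rewrite Yu.
Qed.

Lemma decoded (j : user) w v :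
  ~~ decoding_error C w -> ~~ decoding_error C v ->
  (outputs C w n).2 j = (outputs C v n).2 j -> sent_of w j = sent_of v j ->
  forall l, dst l = j -> w l = v l.
Proof.
rewrite !negb_exists => /forallP/(_ j)/negbNE/eqP wj /forallP/(_ j)/negbNE/eqP vj.
move=> y s l lj; have ljb : dst l == j by apply/eqP.
have /ffunP/(_ (exist _ l ljb)) : wanted_of w j = wanted_of v j.
  by rewrite -wj -vj y s.
by rewrite !ffunE.
Qed.

End Code.

Lemma sent_of_eq (M : link -> nat) (w v : messages M) (j : user) :
  (forall l, src l = j -> w l = v l) -> sent_of w j = sent_of v j.
Proof. by move=> wv; apply/ffunP => l; rewrite !ffunE wv //; apply/eqP/(valP l). Qed.

(** * Cuts and the counting of correctly decoded tuples *)

Definition cut (k : nat) (S : pred link) : Prop :=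
  forall (n : nat) (M : link -> nat) (C : code N n M),
  exists sig : messages M -> n.-tuple {ffun 'I_k -> 'F_2},
  forall w v, ~~ decoding_error C w -> ~~ decoding_error C v ->
    (forall l, ~~ S l -> w l = v l) -> sig w = sig v -> w = v.

Lemma cut_count (k n : nat) (S : pred link) (M : link -> nat) (C : code N n M) :
  cut k S ->
  (#|[pred w | ~~ decoding_error C w]| <=
    (\prod_(l | ~~ S l) M l) * 2 ^ (k * n))%N.
Proof.
move=> /(_ n M C)[sig sigP].
pose T := {dffun forall l : {l : link | ~~ S l}, 'I_(M (val l))}.
pose f (w : messages M) : T * n.-tuple {ffun 'I_k -> 'F_2} :=
  ([ffun l : {l : link | ~~ S l} => w (val l)], sig w).
have -> : ((\prod_(l | ~~ S l) M l) * 2 ^ (k * n))%N =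
    #|{: T * n.-tuple {ffun 'I_k -> 'F_2}}|.
  rewrite card_prod card_tuple card_ffun !card_ord -expnM; congr (_ * _)%N.
  rewrite card_dep_ffun foldrE big_map big_enum /=.
  rewrite (big_sub (fun l => ~~ S l)) /=.
  by apply: eq_bigr => l _; rewrite card_ord.
apply: (@leq_card_in _ _ f) => w v wg vg [/ffunP wv ?].
apply: sigP => // l Sl; have := wv (exist _ l Sl); by rewrite !ffunE.
Qed.

End Channel.

Lemma user_ind (P : user -> Prop) : P u1 -> P u2 -> P u3 -> forall j, P j.
Proof.
move=> P1 P2 P3 [[|[|[|//]]] j3]; [move: P1|move: P2|move: P3];
  by congr P; apply: val_inj.
Qed.

Lemma link_ind (P : link -> Prop) :
  P l12 -> P l13 -> P l21 -> P l23 -> P l31 -> P l32 -> forall l, P l.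
Proof.
move=> P12 P13 P21 P23 P31 P32 [[j k] jk]; move: j k jk.
by elim/user_ind; elim/user_ind => jk //;
  [move: P12|move: P13|move: P21|move: P23|move: P31|move: P32];
  congr P; apply: val_inj.
Qed.

(** * The eight cuts of the converse *)

Section Cuts.
Variables n1 n2 n3 : nat.
Hypotheses (h12 : (n2 <= n1)%N) (h23 : (n3 <= n2)%N).
Local Notation N := (DYC n1 n2 n3).

Lemma levels_DYC : levels N = n1.
Proof.
apply/eqP; rewrite eqn_leq (leq_levels N u1) andbT.
by apply/bigmax_leqP; elim/user_ind => _ //=; apply: leq_trans h12.
Qed.

Lemma downlink_cut (j : user) (S : pred link) :
  (forall (n : nat) (M : link -> nat) (C : code N n M) (w v : messages M),
    ~~ decoding_error C w -> ~~ decoding_error C v ->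
    (forall l, ~~ S l -> w l = v l) ->
    (forall k, (N k <= N j)%N -> (outputs C w n).2 k = (outputs C v n).2 k) ->
    forall l, w l = v l) ->
  cut N (N j) S.
Proof.
move=> H n M C.
exists (fun w => map_tuple (bottom (N j)) ((outputs C w n).2 j)) => w v wg vg wv.
move=> /(congr1 val)/outputs_bottom_user yj; apply/ffunP/(H _ _ C) => // k kj.
exact: outputs_degraded yj.
Qed.

(** A user with more than [k] levels sends no message of [S], so its messages are the same in both
    tuples; [outputs_bottom_relay] then recovers the whole relay observation, which fixes all user
    outputs. *)
Lemma uplink_cut (k : nat) (S : pred link) : (k <= n1)%N ->
  (forall l, S l -> (N (src l) <= k)%N) ->
  (forall (n : nat) (M : link -> nat) (C : code N n M) (w v : messages M),
    ~~ decoding_error C w -> ~~ decoding_error C v ->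
    (forall l, ~~ S l -> w l = v l) ->
    (forall j, (outputs C w n).2 j = (outputs C v n).2 j) ->
    forall l, w l = v l) ->
  cut N k S.
Proof.
move=> kq Sk H n M C.
exists (fun w => map_tuple (bottom k) (outputs C w n).1) => w v wg vg wv.
move=> /(congr1 val)/outputs_bottom_relay y; apply/ffunP/(H _ _ C) => //.
apply: outputs_relay_user; apply: y; first by rewrite levels_DYC.
move=> j kj; apply: sent_of_eq => l lj; apply: wv; apply: contraL kj => /Sk.
by rewrite lj leqNgt.
Qed.

Ltac sent_known := apply: sent_of_eq; elim/link_ind => //= _; auto.

(** A user none of whose own messages lies in the cut decodes first; what it learns supplies the
    sent message that the next user lacks. The other three-link cuts proceed alike; in the two-link
    cuts the first kind of step suffices. *)
Lemma cut_12_32_13 : cut N n2 (mem [:: l12; l32; l13]).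
Proof.
apply: (@downlink_cut u2) => n M C w v wg vg wv y.
have [w21 w23 w31] : [/\ w l21 = v l21, w l23 = v l23 & w l31 = v l31].
  by split; apply: wv.
have D := @decoded _ _ _ C _ w v wg vg.
have D2 : forall l, dst l = u2 -> w l = v l.
  by apply: (D u2); [exact: y|sent_known].
have w32 := D2 l32 erefl.
have D3 : forall l, dst l = u3 -> w l = v l.
  by apply: (D u3); [exact: y|sent_known].
by elim/link_ind; auto.
Qed.

Lemma cut_12_32_31 : cut N n1 (mem [:: l12; l32; l31]).
Proof.
apply: (@downlink_cut u1) => n M C w v wg vg wv y.
have [w21 w23 w13] : [/\ w l21 = v l21, w l23 = v l23 & w l13 = v l13].
  by split; apply: wv.
have D := @decoded _ _ _ C _ w v wg vg.
have D2 : forall l, dst l = u2 -> w l = v l.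
  by apply: (D u2); [exact: y|sent_known].
have w12 := D2 l12 erefl.
have D1 : forall l, dst l = u1 -> w l = v l.
  by apply: (D u1); [exact: y|sent_known].
by elim/link_ind; auto.
Qed.

Lemma cut_13_23_12 : cut N n2 (mem [:: l13; l23; l12]).
Proof.
apply: (@downlink_cut u2) => n M C w v wg vg wv y.
have [w31 w32 w21] : [/\ w l31 = v l31, w l32 = v l32 & w l21 = v l21].
  by split; apply: wv.
have D := @decoded _ _ _ C _ w v wg vg.
have D3 : forall l, dst l = u3 -> w l = v l.
  by apply: (D u3); [exact: y|sent_known].
have w23 := D3 l23 erefl.
have D2 : forall l, dst l = u2 -> w l = v l.
  by apply: (D u2); [exact: y|sent_known].
by elim/link_ind; auto.
Qed.

Lemma cut_13_23_21 : cut N n1 (mem [:: l13; l23; l21]).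
Proof.
apply: (@downlink_cut u1) => n M C w v wg vg wv y.
have [w31 w32 w12] : [/\ w l31 = v l31, w l32 = v l32 & w l12 = v l12].
  by split; apply: wv.
have D := @decoded _ _ _ C _ w v wg vg.
have D3 : forall l, dst l = u3 -> w l = v l.
  by apply: (D u3); [apply: y; apply: leq_trans h12|sent_known].
have w13 := D3 l13 erefl.
have D1 : forall l, dst l = u1 -> w l = v l.
  by apply: (D u1); [exact: y|sent_known].
by elim/link_ind; auto.
Qed.

Lemma cut_13_23 : cut N n3 (mem [:: l13; l23]).
Proof.
apply: (@downlink_cut u3) => n M C w v wg vg wv y.
have [w12 w21 w31 w32] :
    [/\ w l12 = v l12, w l21 = v l21, w l31 = v l31 & w l32 = v l32].
  by split; apply: wv.
have D3 : forall l, dst l = u3 -> w l = v l.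
  by apply: (@decoded _ _ _ C u3 w v); [| |exact: y|sent_known].
by elim/link_ind; auto.
Qed.

Lemma cut_21_31_32 : cut N n2 (mem [:: l21; l31; l32]).
Proof.
apply: uplink_cut => //; first by elim/link_ind.
move=> n M C w v wg vg wv y.
have [w12 w13 w23] : [/\ w l12 = v l12, w l13 = v l13 & w l23 = v l23].
  by split; apply: wv.
have D := fun j => @decoded _ _ _ C j w v wg vg (y j).
have D1 : forall l, dst l = u1 -> w l = v l by apply: (D u1); sent_known.
have w21 := D1 l21 erefl.
have D2 : forall l, dst l = u2 -> w l = v l by apply: (D u2); sent_known.
by elim/link_ind; auto.
Qed.

Lemma cut_21_31_23 : cut N n2 (mem [:: l21; l31; l23]).
Proof.
apply: uplink_cut => //; first by elim/link_ind.
move=> n M C w v wg vg wv y.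
have [w12 w13 w32] : [/\ w l12 = v l12, w l13 = v l13 & w l32 = v l32].
  by split; apply: wv.
have D := fun j => @decoded _ _ _ C j w v wg vg (y j).
have D1 : forall l, dst l = u1 -> w l = v l by apply: (D u1); sent_known.
have w31 := D1 l31 erefl.
have D3 : forall l, dst l = u3 -> w l = v l by apply: (D u3); sent_known.
by elim/link_ind; auto.
Qed.

Lemma cut_31_32 : cut N n3 (mem [:: l31; l32]).
Proof.
apply: uplink_cut; [exact: leq_trans h12|by elim/link_ind|].
move=> n M C w v wg vg wv y.
have [w12 w13 w21 w23] :
    [/\ w l12 = v l12, w l13 = v l13, w l21 = v l21 & w l23 = v l23].
  by split; apply: wv.
have D := fun j => @decoded _ _ _ C j w v wg vg (y j).
have D1 : forall l, dst l = u1 -> w l = v l by apply: (D u1); sent_known.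
have D2 : forall l, dst l = u2 -> w l = v l by apply: (D u2); sent_known.
by elim/link_ind; auto.
Qed.

End Cuts.

(** * The converse for rates *)

Section Rates.
Variable R : realType.
Import numFieldNormedType.Exports.
Local Open Scope ring_scope.
Local Open Scope classical_set_scope.

Lemma ler_powR2 (x y : R) : (2 `^ x <= 2 `^ y) = (x <= y).
Proof.
rewrite -[LHS]ler_ln ?posrE ?powR_gt0 // !ln_powR ler_pM2r //.
by rewrite ln_gt0 // ltr1n.
Qed.

Lemma powR2_sum (I : finType) (P : pred I) (r : I -> R) (x : R) :
  2 `^ (x * \sum_(i | P i) r i) = \prod_(i | P i) 2 `^ (x * r i).
Proof.
rewrite mulr_sumr; elim/big_rec2: _ => [|i y z _ <-]; first by rewrite powRr0.
by rewrite powRD // pnatr_eq0 implybT.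
Qed.

Lemma message_count_gt0 (n : nat) (r : rate_tuple R) (l : link) :
  0 <= r l -> (0 < message_count n r l)%N.
Proof.
move=> r0; rewrite truncn_gt0 -[leLHS](powRr0 2) ler_powR2.
by rewrite mulr_ge0.
Qed.

(** Rounding a real number that is at least 1 down to an integer loses less than a factor 2. *)
Lemma message_count_ge (n : nat) (r : rate_tuple R) (l : link) :
  0 <= r l -> 2 `^ (n%:R * r l) <= 2 * (message_count n r l)%:R.
Proof.
move=> r0; have := message_count_gt0 n r0; rewrite -(ler1n R) /message_count => M1.
have /andP[_ /ltW] := truncn_itv (powR_ge0 2 (n%:R * r l)).
move=> /le_trans; apply; set t := Num.truncn _ in M1 *.
by rewrite -[t.+1%:R]natr1 mulr_natl mulr2n lerD2l.
Qed.

(** A constant error level is enough for the converse: the factor 2 lost here only adds 1 to an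
    exponent that is compared with multiples of [n]. *)
Lemma error_probability_lt_half (N : user -> nat) (n : nat) (M : link -> nat)
    (C : code N n M) : (forall l, 0 < M l)%N -> error_probability R C < 2^-1 ->
  (\prod_l M l < 2 * #|[pred w | ~~ decoding_error C w]|)%N.
Proof.
move=> M0.
have cM : #|{: messages M}| = (\prod_l M l)%N.
  rewrite card_dep_ffun foldrE big_map big_enum /=.
  by apply: eq_bigr => l _; rewrite card_ord.
have M_gt0 : (0 < \prod_l M l)%N by apply: prodn_gt0.
rewrite /error_probability cM ltr_pdivrMr ?ltr0n // mulrC ltr_pdivlMr //.
rewrite -natrM ltr_nat -cM -(cardC [pred w | decoding_error C w]).
have -> : #|[predC [pred w | decoding_error C w]]| =
    #|[pred w | ~~ decoding_error C w]| by apply: eq_card.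
by rewrite muln2 -addnn ltn_add2l mul2n -addnn ltn_add2r.
Qed.

Lemma achievable_cut (N : user -> nat) (r : rate_tuple R) (k : nat)
    (S : pred link) :
  achievable N r -> cut N k S -> \sum_(l | S l) r l <= k%:R.
Proof.
(* One factor 2 for each message set of [S] that was rounded down, and one for the tuples decoded
   wrongly. *)
move=> [r0 [C errC]] Sk; pose c := #|S|.+1.
have bound n : error_probability R (C n) < 2^-1 ->
    n%:R * (\sum_(l | S l) r l - k%:R) <= c%:R.
  move=> /(error_probability_lt_half (fun l => message_count_gt0 n (r0 l))).
  set M := message_count n r => goodC.
  have: (\prod_(l | S l) M l <= 2 * 2 ^ (k * n))%N.
    (* The messages outside [S] occur on both sides and cancel. *)
    have M0 : (0 < \prod_(l | ~~ S l) M l)%N.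
      by apply: prodn_cond_gt0 => l _; apply: message_count_gt0.
    rewrite -(leq_pmul2r M0).
    have -> : (\prod_(l | S l) M l * \prod_(l | ~~ S l) M l = \prod_l M l)%N.
      by rewrite [RHS](bigID S).
    rewrite (leq_trans (ltnW goodC)) //.
    by rewrite -mulnA leq_mul2l /= mulnC; apply: cut_count.
  rewrite -(ler_nat R) natr_prod => MS.
  rewrite mulrBr lerBlDr -ler_powR2 powR2_sum.
  rewrite -natrM -natrD powR_mulrn //.
  apply: (@le_trans _ _ (\prod_(l | S l) (2 * (M l)%:R))).
    by apply: ler_prod => l _; rewrite powR_ge0 message_count_ge.
  rewrite big_split /= prodr_const addSnnS exprD ler_pM2l ?exprn_gt0 //.
  by rewrite exprS mulnC (le_trans MS) // natrM natrX.
rewrite leNgt; apply/negP => kS; pose e := \sum_(l | S l) r l - k%:R.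
have e0 : 0 < e by rewrite subr_gt0.
have half : (0 : R) < 2^-1 by rewrite invr_gt0.
(* As [c] and [e] do not depend on [n], a large [n] contradicts [bound]. *)
have [n [errn cn]] : exists n, error_probability R (C n) < 2^-1 /\ c%:R / e < n%:R.
  near \oo => n; exists n; split; near: n; last exact: nbhs_infty_gtr.
  exact: (cvgr_lt 0 errC).
by have := bound n errn; rewrite leNgt -ltr_pdivrMr // cn.
Unshelve. all: by end_near. Qed.

(** The capacity region is a closure; closed conditions pass to it from the achievable tuples. *)
Lemma closed_rate_sum_le (S : pred link) (c : R) :
  closed [set r : rate_tuple R | \sum_(l | S l) r l <= c].
Proof.
pose f (r : rate_tuple R) : R := \sum_(l | S l) r l.
have cf : continuous f.
  apply: continuous_big => [|l _]; first exact: add_continuous.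
  exact: (@proj_continuous _ (fun=> R) l).
exact: (closed_comp (fun r _ => cf r) (@closed_le R c)).
Qed.

Lemma closed_rate_ge0 (l : link) : closed [set r : rate_tuple R | 0 <= r l].
Proof.
have cl : continuous (fun r : rate_tuple R => r l) := @proj_continuous _ (fun=> R) l.
exact: (closed_comp (fun r _ => cl r) (@closed_ge R 0)).
Qed.

Lemma capacity_region_cut (N : user -> nat) (r : rate_tuple R) (k : nat)
    (S : pred link) :
  capacity_region R N r -> cut N k S -> \sum_(l | S l) r l <= k%:R.
Proof.
move=> rC Sk; apply: (closed_rate_sum_le (S := S)); apply: closure_subset rC.
by move=> s /achievable_cut; apply.
Qed.

Lemma capacity_region_ge0 (N : user -> nat) (r : rate_tuple R) (l : link) :
  capacity_region R N r -> 0 <= r l.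
Proof.
move=> rC; apply: (@closed_rate_ge0 l); apply: closure_subset rC => s.
by case=> /(_ l).
Qed.

Lemma capacity_region_sub_Cbar (n1 n2 n3 : nat) :
  (n2 <= n1)%N -> (n3 <= n2)%N ->
  capacity_region R (DYC n1 n2 n3) `<=` Cbar R n1 n2 n3.
Proof.
move=> h12 h23 r rC; split; first by move=> l; apply: capacity_region_ge0 rC.
have B S : uniq S -> forall k, cut (DYC n1 n2 n3) k (mem S) ->
    \sum_(l <- S) r l <= k%:R.
  by move=> uS k /(capacity_region_cut rC); rewrite big_uniq.
have B3 l l' l'' k : uniq [:: l; l'; l''] ->
    cut (DYC n1 n2 n3) k (mem [:: l; l'; l'']) -> r l + r l' + r l'' <= k%:R.
  by move=> /B H /H; rewrite !big_cons big_nil addr0 addrA.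
have B2 l l' k : uniq [:: l; l'] ->
    cut (DYC n1 n2 n3) k (mem [:: l; l']) -> r l + r l' <= k%:R.
  by move=> /B H /H; rewrite !big_cons big_nil addr0.
split; [split| | | |].
- by apply: B3 => //; apply: cut_12_32_13.
- by apply: B3 => //; apply: cut_12_32_31.
- by apply: B3 => //; apply: cut_21_31_32.
- by apply: B3 => //; apply: cut_21_31_23.
- by apply: B3 => //; apply: cut_13_23_12.
- by apply: B3 => //; apply: cut_13_23_21.
- by apply: B2 => //; apply: cut_31_32.
- by apply: B2 => //; apply: cut_13_23.
Qed.

End Rates.

(** * Placing elements into nested intervals of positions *)

Section Placement.
Variables (W : finType) (k : nat) (cl : W -> 'I_k) (A : 'I_k -> nat).

(** Rank by decreasing class, ties broken by [enum_rank]. The elements up to and including [w] have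
    class at least [cl w], so at most [A (cl w)] of them exist, and the rank of [w] counts all of
    these but [w]. *)
Lemma nested_placement :
  (forall w, #|[pred w' | (cl w <= cl w')%N]| <= A (cl w))%N ->
  exists2 pos : W -> nat, injective pos & forall w, (pos w < A (cl w))%N.
Proof.
move=> WA.
pose before w w' := (cl w' < cl w)%N ||
  (cl w' == cl w :> nat) && (enum_rank w < enum_rank w')%N.
pose pos w' := #|[pred w | before w w']|.
have before_pos w w' : before w w' -> (pos w < pos w')%N.
  move=> ww'; apply: proper_card; apply/fintype.properP; split.
    by apply/fintype.subsetP => z; rewrite !inE; move: ww'; rewrite /before; lia.
  by exists w; rewrite !inE // /before !ltnn andbF.
exists pos => [w w' ww'|w].
  apply: contra_eq (ww') => w_w'; rewrite neq_ltn.
  have rw : (enum_rank w != enum_rank w' :> nat).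
    by apply: contraNN w_w' => /eqP/val_inj/enum_rank_inj ->.
  have /orP[/before_pos->//|/before_pos->] : before w w' || before w' w.
    by rewrite /before; lia.
  by rewrite orbT.
apply: leq_trans (WA w); apply: proper_card; apply/fintype.properP; split.
  by apply/fintype.subsetP => z; rewrite !inE /before; lia.
by exists w; rewrite !inE // /before !ltnn andbF.
Qed.

End Placement.

Lemma eq_digits (D m m' : nat) : (m < 2 ^ D)%N -> (m' < 2 ^ D)%N ->
  (forall e, (e < D)%N -> odd (m %/ 2 ^ e) = odd (m' %/ 2 ^ e)) -> m = m'.
Proof.
elim: D m m' => [|D IHD] m m'; first by rewrite expn0; lia.
rewrite expnS => mD mD' mm'.
have := mm' 0 isT; rewrite expn0 !divn1 => odd_mm'.
have half_mm' : m %/ 2 = m' %/ 2.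
  apply: IHD; rewrite ?ltn_divLR // 1?mulnC // => e eD.
  by rewrite -!divnMA -expnS mm'.
by rewrite (divn_eq m 2) (divn_eq m' 2) half_mm' !modn2 odd_mm'.
Qed.

(** * Codes whose users ignore feedback *)

Section FeedbackFree.
Variables (N : user -> nat) (n : nat) (M : link -> nat).
Local Notation symbol := (symbol N).
Variables (x : forall j : user, nat -> sent M j -> symbol)
  (z : nat -> seq symbol -> symbol).

Definition relay_output (w : messages M) (i : nat) : symbol :=
  uplink (fun j => x i (sent_of w j)).

Definition user_output (w : messages M) (j : user) (i : nat) : symbol :=
  downlink (z i (mkseq (relay_output w) i)) j.

Definition feedback_free_code dec : code N n M :=
  Code (fun j i s _ => x i s) (fun i y => z i (val y)) dec.

Lemma feedback_free_outputs dec (w : messages M) (t : nat) :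
  let out := outputs (feedback_free_code dec) w t in
  val out.1 = mkseq (relay_output w) t /\
  forall j, val (out.2 j) = mkseq (user_output w j) t.
Proof.
elim: t => [|t] //=; case: (outputs _ _ _) => yr yu /= [IHr IHu].
by split=> [|j]; rewrite ?IHr ?IHu mkseqS.
Qed.

(** The decoder picks any tuple consistent with its observation and its own messages; by hypothesis
    all such tuples agree on the wanted messages. *)
Lemma feedback_free_zero_error (w0 : messages M) :
  (forall (w w' : messages M) j, (forall l, src l = j -> w l = w' l) ->
    (forall i, (i < n)%N -> user_output w j i = user_output w' j i) ->
    forall l, dst l = j -> w l = w' l) ->
  exists C : code N n M, forall w, ~~ decoding_error C w.
Proof.
(* The outputs do not depend on the decoder, so a code with a dummy decoder serves to define the
   real one. *)
move=> H; pose C0 := feedback_free_code (fun j _ _ => wanted_of w0 j).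
pose consistent j y s (w : messages M) := (((outputs C0 w n).2 j == y) && (sent_of w j == s)).
exists (feedback_free_code
  (fun j y s => wanted_of (odflt w0 [pick w | consistent j y s w]) j)) => w.
rewrite negb_exists; apply/forallP => j; apply/negPn.
set y := (outputs _ w n).2 j.
have yE : y = (outputs C0 w n).2 j.
  by apply: val_inj; rewrite !(feedback_free_outputs _ _ _).2.
have {yE} -> /= : decoder (feedback_free_code
  (fun j y s => wanted_of (odflt w0 [pick w | consistent j y s w]) j)) y (sent_of w j) =
   wanted_of (odflt w0 [pick w' | consistent j ((outputs C0 w n).2 j) (sent_of w j) w']) j.
  by rewrite yE.
case: pickP => [w'|/(_ w)]; last by rewrite /consistent !eqxx.
move=> /andP[/eqP/(congr1 val) yw /eqP/ffunP sw] /=; apply/eqP/ffunP => l.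
rewrite !ffunE; apply: (H _ _ j); last exact/eqP/(valP l).
  move=> l' /eqP l'j; have := sw (exist _ l' l'j); by rewrite !ffunE.
move=> i ni; move: yw; rewrite !(feedback_free_outputs _ _ _).2.
by move=> /(congr1 (fun s => nth 0%R s i)); rewrite !nth_mkseq.
Qed.

End FeedbackFree.

(** For a user with [c] of the [d] levels, level [b] from the bottom of the relay's observation is
    row [c - 1 - b] of the user's input; the last equation reads [b] back from that row. *)
Lemma uplink_row (b c d : nat) : b < c -> c <= d ->
  [/\ d - c <= d.-1 - b < d, d.-1 - b - (d - c) < d &
    c.-1 - (d.-1 - b - (d - c)) = b].
Proof. by move=> bc cd; split; lia. Qed.

Lemma downlink_row (b c d : nat) : b < c -> c <= d ->
  (d - c <= d - c + b < d) /\ b < d.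
Proof. by move=> bc cd; split; lia. Qed.

(** * The block code built from a placement of wires *)

Section BlockCode.
Variables (N : user -> nat) (K : nat) (K_gt0 : (0 < K)%N).
Variables (W : finType) (terms : W -> seq (link * nat)) (up dn : W -> nat).
Variable a : link -> nat.
Hypotheses (up_inj : injective up) (dn_inj : injective dn).
Hypothesis up_lt : forall w, (up w < K * levels N)%N.
Hypothesis up_src : forall w x, x \in terms w -> (up w < K * N (src x.1))%N.
Variables (n : nat) (M : link -> nat).
Local Notation q := (levels N).
Local Open Scope ring_scope.

Definition bit (m e : nat) : 'F_2 := (odd (m %/ 2 ^ e))%:R.

Lemma bit_odd (m m' e : nat) :
  bit m e = bit m' e -> odd (m %/ 2 ^ e) = odd (m' %/ 2 ^ e).
Proof. by rewrite /bit; do 2!case: odd. Qed.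

(** Total in [l], to avoid carrying proofs about sources; the default 0 arises only for links of
    other users, which [block_user_row] filters out. *)
Definition own_message (j : user) (s : sent M j) (l : link) : nat :=
  if insub l is Some l' then val (s l') else 0%N.

Lemma own_message_sent_of (w : messages M) (j : user) (l : link) :
  src l == j -> own_message (sent_of w j) l = w l.
Proof. by move=> lj; rewrite /own_message insubT ffunE. Qed.

(** Block [t] carries the binary digits [t * a l], ..., [t * a l + a l - 1] of each message. *)
Definition block_bit (m : link -> nat) (t : nat) (l : link) (i : nat) : 'F_2 :=
  bit (m l) (t * a l + i).

Definition message_bit (m : messages M) := block_bit (fun l => m l).

Definition wire_value (m : link -> nat -> 'F_2) (w : W) : 'F_2 :=
  \sum_(x <- terms w) m x.1 x.2.

(* The position [b * K + s] of a block is the level [b] at its time [s]. Uplink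
   levels are counted from the bottom of the relay's observation, downlink levels
   from the top of its input, so that user j reaches exactly the positions below
   [K * N j] on both sides. *)
Definition block_user_row (j : user) (i : nat) (s : sent M j) (r : nat) : 'F_2 :=
  \sum_(w | (up w == ((N j).-1 - r) * K + i %% K)%N)
    \sum_(x <- terms w | src x.1 == j) block_bit (own_message s) (i %/ K) x.1 x.2.

Definition block_user_enc (j : user) (i : nat) (s : sent M j) : symbol N :=
  \col_(r < q) block_user_row i s r.

(** Each wire received in one block is sent on in the next. The sum has at most one term, as [dn] is
    injective, and gives 0 at free positions. In the first block the predecessor is truncated at 0;
    [entry_user_output] claims nothing about those times. *)
Definition block_relay_row (i : nat) (y : seq (symbol N)) (r : nat) : 'F_2 :=
  \sum_(w | (dn w == r * K + i %% K)%N)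
    entry (nth 0 y ((i %/ K).-1 * K + up w %% K)) (q.-1 - up w %/ K).

Definition block_relay_enc (i : nat) (y : seq (symbol N)) : symbol N :=
  \col_(r < q) block_relay_row i y r.

(** The channel does the addition: each user sends the terms of which it is the source, and by
    [up_src] a user that cannot reach the level has none. *)
Lemma entry_relay_output (m : messages M) (t : nat) (w : W) :
  entry (relay_output block_user_enc m (t * K + up w %% K)) (q.-1 - up w %/ K) =
  wire_value (message_bit m t) w.
Proof.
rewrite /wire_value entry_sum.
transitivity (\sum_j \sum_(x <- terms w | src x.1 == j) message_bit m t x.1 x.2).
  apply: eq_bigr => j _; rewrite entry_link.
  have up_q : (up w %/ K < q)%N by rewrite ltn_divLR // mulnC.
  have jq := leq_levels N j.
  case: (ltnP (up w %/ K) (N j)) => [up_j|j_up]; last first.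
    rewrite ifN; last by lia.
    rewrite big_seq_cond big_pred0 // => x; apply/negP => /andP[/up_src + /eqP xj].
    by rewrite xj mulnC -ltn_divLR // ltnNge j_up.
  have [rq rq' rE] := uplink_row up_j jq.
  rewrite rq entry_col rq' /block_user_row rE.
  rewrite modnMDl modn_mod -divn_eq divnMDl // divn_small ?ltn_mod // addn0.
  rewrite (big_pred1 w); last by move=> w'; rewrite (inj_eq up_inj).
  by apply: eq_bigr => x xj; rewrite /message_bit /block_bit own_message_sent_of.
rewrite (exchange_big_dep xpredT) //=; apply: eq_bigr => x _.
by rewrite (big_pred1 (src x.1)) // => j; rewrite eq_sym.
Qed.

Lemma entry_user_output (m : messages M) (j : user) (t : nat) (w : W) :
  (dn w < K * N j)%N ->
  entry (user_output block_user_enc block_relay_enc m j (t.+1 * K + dn w %% K))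
    (q - N j + dn w %/ K) = wire_value (message_bit m t) w.
Proof.
rewrite mulnC -ltn_divLR // => dn_j; have jq := leq_levels N j.
have [rq rq'] := downlink_row dn_j jq.
rewrite entry_link rq addKn entry_col rq' /block_relay_row.
rewrite modnMDl modn_mod -divn_eq divnMDl // divn_small ?ltn_mod // addn0 /=.
rewrite (big_pred1 w); last by move=> w'; rewrite (inj_eq dn_inj).
(* Causality: the observation that is forwarded lies in block [t], before the present time. *)
rewrite nth_mkseq ?entry_relay_output // mulSn.
by rewrite addnC ltn_addr // ltn_add2r ltn_mod.
Qed.

Hypothesis decodable : forall (j : user) (m m' : link -> nat -> 'F_2),
  (forall l, src l = j -> forall i, m l i = m' l i) ->
  (forall w, (dn w < K * N j)%N -> wire_value m w = wire_value m' w) ->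
  forall l, dst l = j -> forall i, (i < a l)%N -> m l i = m' l i.

(** Digit [e] of the message on [l] is bit [e %% a l] of block [e %/ a l]. The block beyond the [B]
    that carry data lets the relay forward the last of them. *)
Lemma block_code (B : nat) (m0 : messages M) :
  (B.+1 * K <= n)%N -> (forall l, M l <= 2 ^ (B * a l))%N ->
  exists C : code N n M, forall m, ~~ decoding_error C m.
Proof.
move=> Bn MB; apply: (feedback_free_zero_error (x := block_user_enc)
  (z := block_relay_enc)) => // m m' j own out l lj.
apply/val_inj/(@eq_digits (B * a l)); rewrite ?(leq_trans (ltn_ord _)) // => e eB.
have a_gt0 : (0 < a l)%N by case: (a l) eB => //; rewrite muln0.
apply: bit_odd; rewrite (divn_eq e (a l)).
have tB : (e %/ a l < B)%N by rewrite ltn_divLR.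
apply: (decodable (j := j) (m := message_bit m (e %/ a l))
  (m' := message_bit m' (e %/ a l))) => //; last by rewrite ltn_mod.
  by move=> l' l'j i; rewrite /message_bit /block_bit own.
move=> w wj; rewrite -!(entry_user_output _ _ wj) out //.
apply: (leq_trans _ Bn); rewrite [(B.+1 * K)%N]mulSn addnC -addSn leq_add ?ltn_mod //.
by rewrite leq_mul2r tB orbT.
Qed.

End BlockCode.

(** The bits of a link fall into those exchanged within a pair, those on a cycle, and the rest. *)
Lemma split_range (P : nat -> Prop) (d c k : nat) :
  (forall i, i < d -> P i) -> (forall i, i < c -> P (d + i)) ->
  (forall i, i < k - (d + c) -> P (d + c + i)) -> forall i, i < k -> P i.
Proof.
move=> Pd Pc Pk i ik; case: (ltnP i d) => [/Pd//|di].
case: (ltnP i (d + c)) => [ic|ci]; first by rewrite -(subnKC di); apply: Pc; lia.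
by rewrite -(subnKC ci); apply: Pk; lia.
Qed.

(** * The wires: contents, decoding and number *)

Section Wires.
Variable a : link -> nat.
Local Open Scope ring_scope.

(* A wire carries, through one uplink and one downlink position of each block,
   the sum of the bits [i] of the links [l] for the pairs (l, i) in [w.1]. Users
   1, .., [w.2.1] can feed its uplink position; users 1, .., [w.2.2] can see its
   downlink position. *)
Definition wire := (seq (link * nat) * (user * user))%type.

Definition wire_family (k : nat) (u d : user) (f : nat -> seq (link * nat)) :
  seq wire := [seq (f i, (u, d)) | i <- iota 0 k].

Definition two_way12 := minn (a l12) (a l21).
Definition two_way13 := minn (a l13) (a l31).
Definition two_way23 := minn (a l23) (a l32).
(** The pairs leave at most one nonzero direction each, so at most one of [cycle123] and [cycle132]
    is positive. *)
Definition cycle123 := minn (minn (a l12 - two_way12) (a l23 - two_way23))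
  (a l31 - two_way13).
Definition cycle132 := minn (minn (a l13 - two_way13) (a l32 - two_way23))
  (a l21 - two_way12).

Local Notation d12 := two_way12.
Local Notation d13 := two_way13.
Local Notation d23 := two_way23.
Local Notation c1 := cycle123.
Local Notation c2 := cycle132.

(** Each wire is labelled by the weakest user that must feed it and the weakest that must see it. On
    a cycle, two users decode from one sum each and the third needs both; user 3 needs only the
    second sum. *)
Definition wire_families : seq (seq wire) :=
 [:: wire_family d12 u2 u2 (fun i => [:: (l12, i); (l21, i)]);
     wire_family d13 u3 u3 (fun i => [:: (l13, i); (l31, i)]);
     wire_family d23 u3 u3 (fun i => [:: (l23, i); (l32, i)]);
     wire_family c1 u2 u2 (fun i => [:: (l12, d12 + i); (l23, d23 + i)]%N);
     wire_family c1 u3 u3 (fun i => [:: (l23, d23 + i); (l31, d13 + i)]%N);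
     wire_family c2 u2 u2 (fun i => [:: (l13, d13 + i); (l21, d12 + i)]%N);
     wire_family c2 u3 u3 (fun i => [:: (l13, d13 + i); (l32, d23 + i)]%N);
     wire_family (a l12 - (d12 + c1)) u1 u2 (fun i => [:: (l12, d12 + c1 + i)]%N);
     wire_family (a l13 - (d13 + c2)) u1 u3 (fun i => [:: (l13, d13 + c2 + i)]%N);
     wire_family (a l21 - (d12 + c2)) u2 u1 (fun i => [:: (l21, d12 + c2 + i)]%N);
     wire_family (a l23 - (d23 + c1)) u2 u3 (fun i => [:: (l23, d23 + c1 + i)]%N);
     wire_family (a l31 - (d13 + c1)) u3 u1 (fun i => [:: (l31, d13 + c1 + i)]%N);
     wire_family (a l32 - (d23 + c2)) u3 u2 (fun i => [:: (l32, d23 + c2 + i)]%N)].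

Definition wires := flatten wire_families.

Lemma wires_src (w : wire) (x : link * nat) :
  w \in wires -> x \in w.1 -> (src x.1 <= w.2.1)%N.
Proof.
pose P := fun w : wire => all (fun x => (src x.1 <= w.2.1)%N) w.1.
have /allP fP : all (all P) wire_families.
  by rewrite /wire_families; do 13?(apply/andP; split) => //;
    rewrite all_map; apply/allP.
by move=> /flattenP[F /fP/allP FP /FP/allP wP] /wP.
Qed.

Lemma count_wire_family (P : pred (user * user)) k u d f :
  count (fun w : wire => P w.2) (wire_family k u d f) = (P (u, d) * k)%N.
Proof.
rewrite count_map (eq_count (a2 := fun=> P (u, d))) //.
by case: P; rewrite ?count_predT ?count_pred0 ?size_iota ?mul1n.
Qed.

Lemma wires_decodable (j : user) (m m' : link -> nat -> 'F_2) :
  (forall l, src l = j -> forall i, m l i = m' l i) ->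
  (forall w, w \in wires -> (j <= w.2.2)%N ->
    \sum_(x <- w.1) m x.1 x.2 = \sum_(x <- w.1) m' x.1 x.2) ->
  forall l, dst l = j -> forall i, (i < a l)%N -> m l i = m' l i.
Proof.
move=> own seen.
have family s k u d f : nth [::] wire_families s = wire_family k u d f ->
    (j <= d)%N -> forall i, (i < k)%N ->
    \sum_(x <- f i) m x.1 x.2 = \sum_(x <- f i) m' x.1 x.2.
  move=> sE jd i ik; apply: (seen (f i, (u, d))) => //; apply/flattenP.
  exists (nth [::] wire_families s); last by rewrite sE map_f ?mem_iota.
  (* An index beyond the list would give an empty family, which [i < k] excludes. *)
  by case: (ltnP s (size wire_families)) => [/mem_nth->|/(nth_default [::])] //;
    rewrite sE; case: k ik {sE}.
have two s k u d (f g : nat -> link * nat) :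
    nth [::] wire_families s = wire_family k u d (fun i => [:: f i; g i]) ->
    (j <= d)%N -> forall i, (i < k)%N ->
    m (f i).1 (f i).2 + m (g i).1 (g i).2 =
      m' (f i).1 (f i).2 + m' (g i).1 (g i).2.
  move=> sE jd i ik; have := family _ _ _ _ _ sE jd i ik.
  by rewrite !big_cons !big_nil !addr0.
have one s k u d (f : nat -> link * nat) :
    nth [::] wire_families s = wire_family k u d (fun i => [:: f i]) ->
    (j <= d)%N -> forall i, (i < k)%N ->
    m (f i).1 (f i).2 = m' (f i).1 (f i).2.
  move=> sE jd i ik; have := family _ _ _ _ _ sE jd i ik.
  by rewrite !big_cons !big_nil !addr0.
have D12 := two 0%N d12 u2 u2 (fun i => (l12, i)) (fun i => (l21, i)) erefl.
have D13 := two 1%N _ _ _ _ _ erefl.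
have D23 := two 2%N _ _ _ _ _ erefl.
have C1a := two 3%N _ _ _ _ _ erefl.
have C1b := two 4%N _ _ _ _ _ erefl.
have C2a := two 5%N _ _ _ _ _ erefl.
have C2b := two 6%N _ _ _ _ _ erefl.
have U12 := one 7%N _ _ _ _ erefl.
have U13 := one 8%N _ _ _ _ erefl.
have U21 := one 9%N _ _ _ _ erefl.
have U23 := one 10%N _ _ _ _ erefl.
have U31 := one 11%N _ _ _ _ erefl.
have U32 := one 12%N _ _ _ _ erefl.
elim/link_ind => jE; subst j.
- apply: (@split_range _ d12 c1) (U12 isT) => i ik.
    by have := D12 isT i ik; rewrite (own l21) //; apply: addIr.
  by have := C1a isT i ik; rewrite (own l23) //; apply: addIr.
- apply: (@split_range _ d13 c2) (U13 isT) => i ik.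
    by have := D13 isT i ik; rewrite (own l31) //; apply: addIr.
  by have := C2b isT i ik; rewrite (own l32) //; apply: addIr.
- apply: (@split_range _ d12 c2) (U21 isT) => i ik.
    by have := D12 isT i ik; rewrite (own l12) //; apply: addrI.
  by have := C2a isT i ik; rewrite (own l13) //; apply: addrI.
- apply: (@split_range _ d23 c1) (U23 isT) => i ik.
    by have := D23 isT i ik; rewrite (own l32) //; apply: addIr.
  by have := C1b isT i ik; rewrite (own l31) //; apply: addIr.
- apply: (@split_range _ d13 c1) (U31 isT) => i ik.
    by have := D13 isT i ik; rewrite (own l13) //; apply: addrI.
  (* User 1 first extracts the bit of [l23] by means of its own bit of [l12], then cancels it in the
     second sum. *)
  have := C1a isT i ik; rewrite (own l12) // => /addrI w23.
  by have := C1b isT i ik; rewrite w23; apply: addrI.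
- apply: (@split_range _ d23 c2) (U32 isT) => i ik.
    by have := D23 isT i ik; rewrite (own l23) //; apply: addrI.
  (* Likewise user 2 first extracts the bit of [l13]. *)
  have := C2a isT i ik; rewrite (own l21) // => /addIr w13.
  by have := C2b isT i ik; rewrite w13; apply: addrI.
Qed.

Variable A : user -> nat.
Hypotheses (A21 : (A u2 <= A u1)%N) (A32 : (A u3 <= A u2)%N).
Hypotheses (a1 : (a l12 + a l32 + a l13 <= A u2)%N)
  (a2 : (a l12 + a l32 + a l31 <= A u1)%N)
  (a3 : (a l21 + a l31 + a l32 <= A u2)%N)
  (a4 : (a l21 + a l31 + a l23 <= A u2)%N)
  (a5 : (a l13 + a l23 + a l12 <= A u2)%N)
  (a6 : (a l13 + a l23 + a l21 <= A u1)%N)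
  (a7 : (a l31 + a l32 <= A u3)%N)
  (a8 : (a l13 + a l23 <= A u3)%N).

Ltac count_cases := rewrite /= ?mul0n ?mul1n ?add0n ?addn0
  /cycle123 /cycle132 /two_way12 /two_way13 /two_way23;
  clear -A21 A32 a1 a2 a3 a4 a5 a6 a7 a8;
  case: (leqP (a l12) (a l21)) => ?; case: (leqP (a l13) (a l31)) => ?;
  case: (leqP (a l23) (a l32)) => ?; rewrite ?subnn ?min0n ?minn0.

(** The count telescopes: for user 3 to [a l31 + a l32]; for user 2 to [a l21 + a l31] plus the
    larger of [a l23] and [a l32]; for user 1 to the sum of the larger load of each pair, less
    [cycle123 + cycle132]. If the larger loads form a directed cycle, the subtraction leaves the
    largest of three bounded sums; otherwise the sum is itself a bounded one. The downlink count has
    the same form with every link reversed. *)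
Lemma count_wires_up (j : user) :
  (count (fun w : wire => (j <= w.2.1)%N) wires <= A j)%N.
Proof.
rewrite count_flatten /= !(count_wire_family (fun p => (j <= p.1)%N)) /=.
move: j; elim/user_ind; count_cases; lia.
Qed.

Lemma count_wires_down (j : user) :
  (count (fun w : wire => (j <= w.2.2)%N) wires <= A j)%N.
Proof.
rewrite count_flatten /= !(count_wire_family (fun p => (j <= p.2)%N)) /=.
move: j; elim/user_ind; count_cases; lia.
Qed.

(** Wires are indexed by their place in the list, which gives the finite type that
    [nested_placement] requires. *)
Lemma wires_placement (g : wire -> user) :
  (forall j : user, count (fun w => (j <= g w)%N) wires <= A j)%N ->
  exists2 pos : 'I_(size wires) -> nat, injective pos &
    forall w, (pos w < A (g (tnth (in_tuple wires) w)))%N.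
Proof.
move=> gA; apply: nested_placement => w; apply: leq_trans (gA _).
set j := g _; rewrite -sum1_count -[X in (_ <= \sum_(_ <- X | _) _)%N]/(in_tuple wires : seq _).
by rewrite big_tnth sum1_card.
Qed.

End Wires.

Lemma zero_error_code (n1 n2 n3 K B n : nat) (a M : link -> nat) :
  (n2 <= n1)%N -> (n3 <= n2)%N -> (0 < K)%N ->
  (a l12 + a l32 + a l13 <= K * n2)%N -> (a l12 + a l32 + a l31 <= K * n1)%N ->
  (a l21 + a l31 + a l32 <= K * n2)%N -> (a l21 + a l31 + a l23 <= K * n2)%N ->
  (a l13 + a l23 + a l12 <= K * n2)%N -> (a l13 + a l23 + a l21 <= K * n1)%N ->
  (a l31 + a l32 <= K * n3)%N -> (a l13 + a l23 <= K * n3)%N ->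
  (B.+1 * K <= n)%N -> (forall l, 0 < M l)%N -> (forall l, M l <= 2 ^ (B * a l))%N ->
  exists C : code (DYC n1 n2 n3) n M, forall m, ~~ decoding_error C m.
Proof.
move=> h12 h23 K0 a1 a2 a3 a4 a5 a6 a7 a8 Bn M0 MB.
pose A j := (K * DYC n1 n2 n3 j)%N.
have A21 : (A u2 <= A u1)%N by rewrite leq_mul2l h12 orbT.
have A32 : (A u3 <= A u2)%N by rewrite leq_mul2l h23 orbT.
have A_anti (j k : user) : (j <= k)%N -> (A k <= A j)%N.
  by elim/user_ind: j; elim/user_ind: k => // _; apply: leq_trans A21.
have [up up_inj up_lt] := wires_placement
  (count_wires_up A21 A32 a1 a2 a3 a4 a5 a6 a7 a8).
have [dn dn_inj dn_lt] := wires_placement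
  (count_wires_down A21 A32 a1 a2 a3 a4 a5 a6 a7 a8).
pose terms w := (tnth (in_tuple (wires a)) w).1.
apply: (@block_code _ K K0 _ terms up dn a up_inj dn_inj _ _ _ _ _ B) => //.
- move=> w; apply: leq_trans (up_lt w) _.
  by rewrite leq_mul2l leq_levels orbT.
- move=> w x xw; apply: leq_trans (up_lt w) _; apply: A_anti.
  by apply: wires_src xw; apply: mem_tnth.
- move=> j m m' own seen; apply: wires_decodable => // w.
  rewrite -[wires a]/(in_tuple (wires a) : seq _) => /tnthP[i ->] ji.
  by apply: (seen i); apply: leq_trans (dn_lt i) _; apply: A_anti.
- exact: [ffun l => Ordinal (M0 l)].
Qed.


(** * Achievable rates and their limit *)

Section Achievability.
Variable R : realType.
Import numFieldNormedType.Exports.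
Local Open Scope ring_scope.
Local Open Scope classical_set_scope.

Definition block_load (K : nat) (r : rate_tuple R) (l : link) : nat :=
  Num.truncn (K%:R * r l).

(* [floor(K r_l)] bits per block of [K] uses, the factor [1 - 1/K] making up for
   the first block, in which the relay is idle, and for an incomplete last one. *)
Definition block_rate (K : nat) (r : rate_tuple R) : rate_tuple R :=
  fun l => (block_load K r l)%:R * (K.-1%:R / (K * K)%:R).

Lemma block_rate_ge0 K r l : 0 <= block_rate K r l.
Proof. by rewrite mulr_ge0 // divr_ge0. Qed.

Lemma block_load_le K r l : 0 <= r l -> (block_load K r l)%:R <= K%:R * r l.
Proof. by move=> r0; rewrite truncn_le mulr_ge0. Qed.

Lemma message_count_block_rate (K n : nat) (r : rate_tuple R) (l : link) :
  (0 < K)%N -> (2 * (K * K) <= n)%N ->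
  (message_count n (block_rate K r) l <= 2 ^ ((n %/ K).-1 * block_load K r l))%N.
Proof.
move=> K0 Kn; rewrite -(ler_nat R); set a := block_load K r l.
have Kpos : 0 < (K * K)%:R :> R by rewrite ltr0n muln_gt0 K0.
(* Since [n %/ K] is at least [2 * K], the first block and the incomplete last one together cost at
   most the factor [1 - 1/K]. *)
have nB : (n * K.-1 <= (n %/ K).-1 * (K * K))%N.
  have : (n < (n %/ K).+1 * K)%N by rewrite ltn_ceil.
  have : (0 < n %/ K)%N by rewrite divn_gt0 //; nia.
  case: (n %/ K)%N => // b _ nb; case: K K0 Kn nb {a Kpos} => // k _ /=; nia.
apply: (@le_trans _ _ (2 `^ (n%:R * block_rate K r l))).
  by rewrite truncn_le powR_ge0.
rewrite natrX -powR_mulrn // ler_powR2 mulrCA mulrA mulrA ler_pdivrMr //.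
by rewrite -!natrM ler_nat -mulnA mulnC [leqRHS]mulnAC leq_mul2r nB orbT.
Qed.

Lemma Cbar_achievable (n1 n2 n3 K : nat) (r : rate_tuple R) :
  (n2 <= n1)%N -> (n3 <= n2)%N -> (0 < K)%N -> Cbar R n1 n2 n3 r ->
  achievable (DYC n1 n2 n3) (block_rate K r).
Proof.
move=> h12 h23 K0 [r0 [[c1 c2 c3 c4] c5 c6 c7 c8]].
split; first exact: block_rate_ge0.
pose a := block_load K r.
have load3 l l' l'' n : r l + r l' + r l'' <= n%:R -> (a l + a l' + a l'' <= K * n)%N.
  move=> lm; rewrite -(ler_nat R) !natrD natrM.
  rewrite (le_trans (lerD (lerD (block_load_le _ _) (block_load_le _ _))
    (block_load_le _ _))) //.
  by rewrite -!mulrDr ler_wpM2l.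
have load2 l l' n : r l + r l' <= n%:R -> (a l + a l' <= K * n)%N.
  move=> lm; rewrite -(ler_nat R) !natrD natrM.
  rewrite (le_trans (lerD (block_load_le _ _) (block_load_le _ _))) //.
  by rewrite -!mulrDr ler_wpM2l.
have H n : exists C : code (DYC n1 n2 n3) n (message_count n (block_rate K r)),
    (2 * (K * K) <= n)%N -> forall m, ~~ decoding_error C m.
  have M0 l := message_count_gt0 n (block_rate_ge0 K r l).
  case: (leqP (2 * (K * K)) n) => [Kn|_].
    have [||C HC] := @zero_error_code n1 n2 n3 K (n %/ K).-1 n a
      (message_count n (block_rate K r)) h12 h23 K0 (load3 _ _ _ _ c1)
      (load3 _ _ _ _ c2) (load3 _ _ _ _ c3) (load3 _ _ _ _ c4)
      (load3 _ _ _ _ c5) (load3 _ _ _ _ c6) (load2 _ _ _ c7) (load2 _ _ _ c8) _ M0.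
    - rewrite prednK ?leq_trunc_div // divn_gt0 //; nia.
    - by move=> l; apply: message_count_block_rate.
    by exists C.
  (* For small [n] any code will do; the sequence needs one of every length. *)
  exists (Code (fun _ _ _ _ => 0) (fun _ _ => 0)
    (fun j _ _ => wanted_of [ffun l => Ordinal (M0 l)] j)) => //.
exists (fun n => projT1 (cid (H n))).
apply: cvg_near_cst; exists (2 * (K * K))%N => // n /= Kn.
rewrite /error_probability eq_card0 ?mul0r // => m.
by rewrite inE; apply/negbTE/(projT2 (cid (H n))).
Qed.

Lemma cvg_block_rate (r : rate_tuple R) : (forall l, 0 <= r l) ->
  (fun k => block_rate k.+1 r) @ \oo --> r.
Proof.
move=> r0; apply/cvg_sup => l U [_ [[V oV <-] Vr] VU].
apply: filterS VU _ => /=.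
have : block_rate k.+1 r l @[k --> \oo] --> r l.
  (* The lower bound is [floor(K r) >= K r - 1] divided by [K], where [K = k.+1] and [harmonic k] is
     [1 / K]. *)
  apply: (@squeeze_cvgr _ _ _ _ (fun k => (r l - harmonic k) * (1 - harmonic k))
    (fun=> r l)) => [| |]; last exact: cvg_cst.
    near=> k; rewrite /block_rate /harmonic /=.
    have k0 : 0 < k.+1%:R :> R by [].
    have /andP[tl tu] := truncn_itv (mulr_ge0 (ltW k0) (r0 l)).
    have -> : k%:R / (k.+1 * k.+1)%:R = (1 - k.+1%:R^-1) / k.+1%:R :> R.
      rewrite natrM invfM mulrA; congr (_ * _).
      by rewrite -[X in X - _](divff (lt0r_neq0 k0)) -[X in X * _ - _]natr1 mulrDl mul1r addrK.
    have h0 : 0 <= 1 - k.+1%:R^-1 :> R by rewrite subr_ge0 invf_le1 ?ler1n.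
    rewrite [(1 - _) / _]mulrC mulrA; apply/andP; split.
      rewrite ler_wpM2r // ler_pdivlMr // mulrBl mulVf ?lt0r_neq0 //.
      by rewrite lerBlDr natr1 mulrC ltW.
    apply: (@le_trans _ _ (r l * (1 - k.+1%:R^-1))).
      by rewrite ler_wpM2r // ler_pdivrMr // mulrC.
    by rewrite ler_piMr // gerBl invr_ge0 ltW.
  have lim (x : R) : x - harmonic k @[k --> \oo] --> x.
    by have := cvgB (cvg_cst x) (@cvg_harmonic R); rewrite subr0; apply.
  by have := cvgM (lim (r l)) (lim 1); rewrite mulr1; apply.
apply; exact: open_nbhs_nbhs.
Unshelve. all: by end_near. Qed.

Lemma Cbar_sub_capacity_region (n1 n2 n3 : nat) :
  (n2 <= n1)%N -> (n3 <= n2)%N ->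
  Cbar R n1 n2 n3 `<=` capacity_region R (DYC n1 n2 n3).
Proof.
move=> h12 h23 r rC B rB.
have /filter_ex[k Bk] : \forall k \near \oo, B (block_rate k.+1 r).
  exact: cvg_block_rate rC.1 B rB.
exists (block_rate k.+1 r); split=> //.
exact: Cbar_achievable.
Qed.

End Achievability.

Theorem theorem4 (R : realType) (n1 n2 n3 : nat)
    (h12 : (n2 <= n1)%N) (h23 : (n3 <= n2)%N) :
  capacity_region R (DYC n1 n2 n3) = Cbar R n1 n2 n3.
Proof.
apply/seteqP; split; first exact: capacity_region_sub_Cbar.
exact: Cbar_sub_capacity_region.
Qed.
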